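(* Let $P(\lambda) = A_2\lambda^2 + A_1\lambda + A_0$, where $A_2$ and $A_0$ are $2\times 2$ permutation matrices and $A_1$ is a $2\times 2$ doubly stochastic matrix. Then the corresponding $4\times 4$ block companion matrix $C = \begin{bmatrix} 0 & I \\ -A_2^{-1}A_0 & -A_2^{-1}A_1\end{bmatrix}$ of $P(\lambda)$ is diagonalizable (over $\mathbb{C}$).
   Context: A nonnegative square matrix is doubly stochastic if all its row sums and column sums equal $1$. $I$ and $0$ denote the $2\times 2$ identity and zero matrices. The block companion matrix of a quadratic matrix polynomial $A_2\lambda^2+A_1\lambda+A_0$ with nonsingular leading coefficient is defined by the displayed formula for $C$. *)

(* Defs.v *)
From mathcomp Require Import all_boot all_order all_algebra.
From mathcomp Require Import reals complex.

Set Implicit Arguments.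
Unset Strict Implicit.
Unset Printing Implicit Defensive.

Import Order.TTheory GRing.Theory Num.Theory.
Local Open Scope ring_scope.

Definition doubly_stochastic (R : numDomainType) (n : nat) (A : 'M[R]_n) : Prop :=
  [/\ forall i j, 0 <= A i j,
      forall i, \sum_j A i j = 1
    & forall j, \sum_i A i j = 1].

(* A matrix polynomial is a polynomial over the ring of square matrices, so
   its coefficients A_0, A_1, A_2 are P`_0, P`_1, P`_2. Only meaningful when P
   has degree 2 and P`_2 is invertible (invmx is the identity otherwise). *)
Definition block_companion (R : comUnitRingType) (n : nat)
    (P : {poly 'M[R]_n.+1}) : 'M[R]_(n.+1 + n.+1) :=
  block_mx 0                        1%:M
           (- (invmx P`_2 *m P`_0)) (- (invmx P`_2 *m P`_1)).

(* Main.v *)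
Require Import Defs.
From mathcomp Require Import all_boot all_order all_algebra.
From mathcomp Require Import reals complex.
From mathcomp Require Import fingroup perm ring lra.

(** A_2^-1 A_0 and A_2^-1 A_1 are 2x2 doubly stochastic, so the Hadamard matrix
    diagonalizes both of them, with eigenvalues 1, m = ±1 and 1, c in [-1, 1].
    The companion matrix thus splits into those of X^2 + X + 1 and
    X^2 + c X + m, whose discriminants -3 and c^2 - 4 m never vanish. *)

Set Implicit Arguments.
Unset Strict Implicit.
Unset Printing Implicit Defensive.

Import Order.TTheory GRing.Theory Num.Theory.
Local Open Scope ring_scope.

(** The quadratic formula for [X^2 + c X + m], stated through Vieta's relations because the
    eigenvector computation uses the roots only through their sum and product. The roots differ by a
    square root [d] of the discriminant. *)
Lemma monic_quadratic_roots (F : numClosedFieldType) (m c : F) :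
  c ^+ 2 - 4%:R * m != 0 ->
  exists x : F * F, [/\ x.1 + x.2 = - c, x.1 * x.2 = m & x.1 != x.2].
Proof.
move=> disc_neq0; pose d := sqrtC (c ^+ 2 - 4%:R * m).
have d2 : d ^+ 2 = c ^+ 2 - 4%:R * m by rewrite sqrtCK.
have d_neq0 : d != 0 by rewrite sqrtC_eq0.
have two_neq0 : 2%:R != 0 :> F by rewrite pnatr_eq0.
exists ((- c + d) / 2%:R, (- c - d) / 2%:R); split => /=; first by field.
  apply: (mulfI (mulf_neq0 two_neq0 two_neq0)).
  transitivity (c ^+ 2 - d ^+ 2); first by field.
  by rewrite d2; ring.
rewrite -subr_eq0.
suff -> : (- c + d) / 2%:R - (- c - d) / 2%:R = d by [].
by field.
Qed.

(* Rows (- s h, h) and (- r h, h), with h a common left eigenvector and r, s the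
   roots of the corresponding quadratic, are left eigenvectors. *)
Lemma diagonalizable_companion (F : numClosedFieldType) (n : nat)
    (H M N : 'M[F]_n) (m c : 'rV[F]_n) :
  H \in unitmx ->
  H *m M = diag_mx m *m H -> H *m N = diag_mx c *m H ->
  (forall i, c 0 i ^+ 2 - 4%:R * m 0 i != 0) ->
  diagonalizable (block_mx 0 1%:M (- M) (- N)).
Proof.
move=> Hu HM HN disc_neq0.
have [rt rtP] := fin_all_exists (fun i => monic_quadratic_roots (disc_neq0 i)).
pose r := \row_i (rt i).1; pose s := \row_i (rt i).2.
have rDs : diag_mx r + diag_mx s = - diag_mx c.
  rewrite -!raddfD /= -raddfN /=; congr diag_mx; apply/rowP => i; rewrite !mxE.
  by case: (rtP i).
have rs_row (x y : 'rV[F]_n) :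
    diag_mx x *m diag_mx y = diag_mx (\row_i (x 0 i * y 0 i)).
  exact: mulmx_diag.
have rMs : diag_mx r *m diag_mx s = diag_mx m.
  rewrite rs_row; congr diag_mx; apply/rowP => i; rewrite !mxE.
  by case: (rtP i).
have sMr : diag_mx s *m diag_mx r = diag_mx m by rewrite diag_mxC.
have rBs : (diag_mx r - diag_mx s) *m
    diag_mx (\row_i (r 0 i - s 0 i)^-1) = 1%:M.
  rewrite -raddfB /= rs_row -diag_const_mx; congr diag_mx; apply/rowP => i.
  rewrite !mxE divff // subr_eq0.
  by case: (rtP i).
set e := \row_i (r 0 i - s 0 i)^-1 in rBs.
pose V := block_mx (- diag_mx s) 1%:M (- diag_mx r) (1%:M : 'M_n).
have Vu : V \in unitmx.
  (* The blocks of [V] are diagonal and commute, so the inverse is that of a 2x2 matrix: the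
     adjugate times the inverse [diag_mx e] of the determinant [r - s]. *)
  suff /mulmx1_unit[] : V *m block_mx (diag_mx e) (- diag_mx e)
     (diag_mx r *m diag_mx e) (- (diag_mx s *m diag_mx e)) = 1%:M by [].
  rewrite mulmx_block !mul1mx !mulNmx !mulmxN !opprK !subrr.
  rewrite (addrC (- _)) addNr -mulmxBl rBs.
  by rewrite -scalar_mx_block.
exists (V *m block_mx H 0 0 H).
  by rewrite unitmx_mul Vu unitmxE det_ublock unitrM -!unitmxE Hu.
(* The companion matrix sends the row [(- s h, h)] to [(- m h, - (s + c) h)], which is
   [r (- s h, h)] as [r s = m] and [r + s = - c]. Hence the rows built from [s] have eigenvalue [r],
   and conversely. *)
apply/diagonalizable_forPex; exists (row_mx r s).
apply/simmxP.
  by rewrite unitmx_mul Vu unitmxE det_ublock unitrM -!unitmxE Hu.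
rewrite diag_mx_row /V !mulmx_block !(mulmx0, mul0mx, mul1mx, mulmx1, addr0, add0r).
rewrite !mulNmx !mulmxN HM HN !mulmxA rMs sMr.
have -> : diag_mx c = - (diag_mx r + diag_mx s) by rewrite rDs opprK.
rewrite mulNmx opprK mulmxDl addKr.
by congr block_mx; rewrite addrC addrK.
Qed.

Definition hadamard2 (R : pzRingType) : 'M[R]_2 :=
  \matrix_(i, j) (-1) ^+ (i * j)%N.

Lemma hadamard2_unit (F : numFieldType) : hadamard2 F \in unitmx.
Proof.
have two_neq0 : 2%:R != 0 :> F by rewrite pnatr_eq0.
(* The square of the Hadamard matrix is twice the identity. *)
suff /mulmx1_unit[] : hadamard2 F *m (2%:R^-1 *: hadamard2 F) = 1%:M by [].
apply/matrixP => i j; rewrite mxE !big_ord_recl big_ord0 !mxE.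
by case: i j => [[|[|//]] ?] [[|[|//]] ?]; rewrite /=; field.
Qed.

(** The sums force [A] to have equal diagonal entries [a] and off-diagonal entries [1 - a], so
    [(1, 1)] and [(1, -1)] are left eigenvectors for [1] and [2 a - 1]. The power [i] selects
    between these two eigenvalues. *)
Lemma doubly_stochastic_hadamard2 (R : numDomainType) (A : 'M[R]_2) :
  doubly_stochastic A ->
  hadamard2 R *m A = diag_mx (\row_i (2%:R * A 0 0 - 1) ^+ i) *m hadamard2 R.
Proof.
case=> _ row_sum col_sum.
have ord2_sum (F : 'I_2 -> R) : \sum_i F i = F 0 + F 1.
  rewrite !big_ord_recl big_ord0 addr0; congr (_ + F _); exact/val_inj.
have A01 : A 0 1 = 1 - A 0 0 by rewrite -(row_sum 0) ord2_sum; ring.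
have A10 : A 1 0 = 1 - A 0 0 by rewrite -(col_sum 0) ord2_sum; ring.
have A11 : A 1 1 = A 0 0.
  by apply: (addrI (A 1 0)); rewrite -ord2_sum row_sum A10; ring.
have ord2P (i : 'I_2) : i = 0 \/ i = 1.
  by case: i => [[|[|//]] ?]; [left | right]; apply: val_inj.
apply/matrixP => i j; rewrite mul_diag_mx !mxE ord2_sum !mxE.
by case: (ord2P i) => ->; case: (ord2P j) => -> /=; rewrite ?A01 ?A10 ?A11; ring.
Qed.

Lemma doubly_stochastic_row_perm (R : numDomainType) (n : nat) (s : 'S_n)
    (A : 'M[R]_n) :
  doubly_stochastic A -> doubly_stochastic (row_perm s A).
Proof.
case=> A_ge0 row_sum col_sum; split=> [i j|i|j].
- by rewrite mxE.
- by under eq_bigr do rewrite mxE; rewrite row_sum.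
under eq_bigr do rewrite mxE.
by rewrite -(col_sum j) [RHS](reindex_inj (@perm_inj _ s)).
Qed.

Lemma doubly_stochastic1 (R : numDomainType) (n : nat) :
  doubly_stochastic (1%:M : 'M[R]_n).
Proof.
split=> [i j|i|j]; first by rewrite mxE ler0n.
  rewrite (bigD1 i) //= mxE eqxx big1 ?addr0 // => j.
  by rewrite mxE eq_sym => /negPf->.
rewrite (bigD1 j) //= mxE eqxx big1 ?addr0 // => i.
by rewrite mxE => /negPf->.
Qed.

Lemma invmx_perm_mx (R : comUnitRingType) (n : nat) (s : 'S_n) :
  invmx (perm_mx s) = perm_mx s^-1 :> 'M[R]_n.
Proof.
rewrite -[RHS](mulKmx (unitmx_perm R s)) -perm_mxM mulgV perm_mx1.
by rewrite mulmx1.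
Qed.

Theorem theorem2p12 (R : realType) (A2 A1 A0 : 'M[R]_2)
    (P : {poly 'M[R]_2}) :
  is_perm_mx A2 -> is_perm_mx A0 -> doubly_stochastic A1 ->
  P = A2%:P * 'X^2 + A1%:P * 'X + A0%:P ->
  diagonalizable (map_mx (real_complex R) (block_companion P)).
Proof.
move=> /existsP[s /eqP A2E] /existsP[t /eqP A0E] A1ds PE.
have [P2 P1 P0] : [/\ P`_2 = A2, P`_1 = A1 & P`_0 = A0].
  by rewrite PE; split; rewrite !coefE ?(mulr0, mulr1, addr0, add0r).
have ME : invmx A2 *m A0 = perm_mx (s^-1 * t)%g.
  by rewrite A2E A0E invmx_perm_mx perm_mxM.
have Mds : doubly_stochastic (invmx A2 *m A0).
  (* A permutation matrix is a row permutation of the identity. *)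
  rewrite ME -[perm_mx _]mulmx1 -row_permE.
  exact/doubly_stochastic_row_perm/doubly_stochastic1.
have Nds : doubly_stochastic (invmx A2 *m A1).
  by rewrite A2E invmx_perm_mx -row_permE; apply: doubly_stochastic_row_perm.
(* This makes the second eigenvalue [2 M00 - 1] equal to -1 or 1. *)
have M00 : (invmx A2 *m A0) 0 0 = 0 \/ (invmx A2 *m A0) 0 0 = 1.
  by rewrite ME !mxE; case: eqP; [right | left].
rewrite /block_companion P2 P1 P0 map_block_mx !map_mxN map_mx0 map_mx1.
move: (invmx A2 *m A0) (invmx A2 *m A1) {ME} Mds M00 Nds => M N Mds M00 Nds.
pose f := real_complex R.
have Hu : map_mx f (hadamard2 R) \in unitmx by rewrite map_unitmx hadamard2_unit.
apply: (diagonalizable_companion Hu).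
- by rewrite -map_mxM doubly_stochastic_hadamard2 // map_mxM map_diag_mx.
- by rewrite -map_mxM doubly_stochastic_hadamard2 // map_mxM map_diag_mx.
(* The discriminants are images of real numbers, so their nonvanishing is checked in [R], where the
   order is total. *)
move=> i; rewrite !mxE -(rmorph_nat f) -rmorphXn -rmorphM -rmorphB fmorph_eq0.
have [N00_ge0 N00_le1] : 0 <= N 0 0 /\ N 0 0 <= 1.
  case: Nds => N_ge0 /(_ 0); rewrite big_ord_recl big_ord1 => row_sum _.
  by split=> //; rewrite -row_sum lerDl.
case: i => [[|[|//]] _] /=; rewrite ?expr0 ?expr1.
  by apply/eqP; lra.
(* With [c = 2 N00 - 1] in [-1, 1], the discriminant is [c^2 + 4 > 0] or [c^2 - 4 < 0]. *)
case: M00 => ->; apply/eqP; nra.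
Qed.
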